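(* If $\mathcal A$ is an $R$-competitive incremental algorithm for frequency allocation on bipartite graphs, then $R\ge 10/7$.
   Context: Frequency allocation: a (possibly infinite) undirected graph $G$ is given. Requests arrive one at a time, each at some vertex. An incremental algorithm must, on arrival of each request, immediately and irrevocably assign it a frequency (a positive integer), such that at every step all requests at a common vertex have distinct frequencies and requests at adjacent vertices have distinct frequencies. The cost is the number of distinct frequencies used. ${\textit{opt}}(G,\bar\ell)$ is the minimum number of frequencies for which such an assignment exists for load vector $\bar\ell$ ($\ell_v$ = number of requests at $v$). An incremental algorithm is $R$-competitive for bipartite graphs if there is a constant $\lambda$ such that for every bipartite graph $G$ and every request sequence with final load vector $\bar\ell$, the number of frequencies used is at most $R\cdot{\textit{opt}}(G,\bar\ell)+\lambda$. *)

(* Defs.v *)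
From Stdlib Require Import Reals List Arith.
Import ListNotations.
Set Implicit Arguments.

(* An incremental (online, deterministic) frequency-allocation algorithm.
   It knows the graph (vertex type V with decidable equality, adjacency
   relation adj) and, on arrival of a request, sees the whole sequence of
   requests so far (the last element is the new request) and returns the
   frequency of the new request.  Since earlier frequencies are values of
   the algorithm on earlier prefixes, assignments are irrevocable. *)
Definition inc_alg : Type :=
  forall (V : Type) (eqV : forall x y : V, {x = y} + {x <> y})
         (adj : V -> V -> bool), list V -> nat.

Definition alg_freq (A : inc_alg) (V : Type)
  (eqV : forall x y : V, {x = y} + {x <> y}) (adj : V -> V -> bool)
  (s : list V) (i : nat) : nat :=
  A V eqV adj (firstn (S i) s).

Definition bipartite_graph (V : Type) (adj : V -> V -> bool) : Prop :=
  (forall u v, adj u v = adj v u) /\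
  (forall v, adj v v = false) /\
  (exists c : V -> bool, forall u v, adj u v = true -> c u <> c v).

Definition conflict (V : Type) (adj : V -> V -> bool) (u v : V) : Prop :=
  u = v \/ adj u v = true.

Definition valid_assign (V : Type) (adj : V -> V -> bool) (s : list V)
  (f : nat -> nat) : Prop :=
  forall i j u v, i < j ->
    nth_error s i = Some u -> nth_error s j = Some v ->
    conflict adj u v -> f i <> f j.

Definition num_freqs (f : nat -> nat) (n : nat) : nat :=
  length (nodup Nat.eq_dec (map f (seq 0 n))).

Definition feasible (V : Type) (adj : V -> V -> bool) (s : list V) (k : nat) : Prop :=
  exists f, valid_assign adj s f /\ num_freqs f (length s) <= k.

Definition is_opt (V : Type) (adj : V -> V -> bool) (s : list V) (k : nat) : Prop :=
  feasible adj s k /\ forall k', feasible adj s k' -> k <= k'.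

Definition competitive_bip (A : inc_alg) (r : R) : Prop :=
  exists lambda : R,
    forall (V : Type) (eqV : forall x y : V, {x = y} + {x <> y})
           (adj : V -> V -> bool),
      bipartite_graph adj ->
      forall s : list V,
        valid_assign adj s (alg_freq A eqV adj s) /\
        forall k, is_opt adj s k ->
          (INR (num_freqs (alg_freq A eqV adj s) (length s)) <= r * INR k + lambda)%R.

(* Main.v *)
Require Import Defs.
From Stdlib Require Import Reals List Arith Lia Lra Bool Classical.
Import ListNotations.

(** The adversary uses one fixed graph and one fixed request sequence, in
    stages [k = 0, 1, ...] with unit [u = 2^k * 2n].  In each stage three pairs
    of fresh vertices, one on each side [A], [B], receive [u] requests each:
    - [S] is not adjacent to any earlier vertex (optimum [u]);
    - [V] is adjacent to the opposite vertices of the previous stages, which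
      have load at most [u/2] (optimum [3u/2]);
    - [U] is adjacent to all earlier opposite vertices (optimum [2u]).
    For a single frequency, write [xA], [xB] for the indicators that it occurs
    on side [A], [B] before the stage, [x'A], [x'B] after it, and [sA], ..., [uB]
    for its occurrence at the six new vertices.  The conflicts imply
    [2(sA+sB+vA+vB) + uA+uB + 2(xA+xB) <= x'A+x'B + 4[used after S] + 2[used after V]].
    Summing over the frequencies, with [c k] the sum of the numbers of
    frequencies seen on the two sides before stage [k],
    [10 u + 2 c k <= c (k+1) + 4 (R u + lambda) + 2 (3 R u / 2 + lambda)],
    so [c k / 2^k] would grow without bound if [7 R < 10], whereas it is at most
    [2 (R * 2n + lambda)]. *)

(** * Offline optimum of bipartite graphs *)

Lemma num_freqs_le f n l :
  (forall i, i < n -> In (f i) l) -> num_freqs f n <= length l.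
Proof.
  intros H. apply NoDup_incl_length; [apply NoDup_nodup|].
  intros g Hg. apply nodup_In, in_map_iff in Hg.
  destruct Hg as (i & <- & Hi). apply in_seq in Hi. apply H. lia.
Qed.

Lemma count_occ_firstn_lt {V : Type} (eqV : forall x y : V, {x = y} + {x <> y})
  (s : list V) i j v :
  i < j -> nth_error s i = Some v ->
  count_occ eqV (firstn i s) v < count_occ eqV (firstn j s) v.
Proof.
  revert i j. induction s as [|w s IH]; intros [|i] [|j] Hij Hi;
    simpl in *; try discriminate; try lia.
  - injection Hi as ->. destruct (eqV v v); [lia|congruence].
  - specialize (IH i j ltac:(lia) Hi). destruct (eqV w v); lia.
Qed.

Lemma count_occ_firstn_total {V : Type} (eqV : forall x y : V, {x = y} + {x <> y})
  (s : list V) i v :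
  nth_error s i = Some v -> count_occ eqV (firstn i s) v < count_occ eqV s v.
Proof.
  intros Hi.
  assert (Hl : i < length s) by (apply nth_error_Some; congruence).
  rewrite <- (firstn_all s) at 2. now apply count_occ_firstn_lt.
Qed.

(* One side takes its frequencies from the bottom of [0, K), the other one from
   the top. *)
Lemma bipartite_feasible {V : Type} (eqV : forall x y : V, {x = y} + {x <> y})
  (adj : V -> V -> bool) (s : list V) (K : nat) :
  bipartite_graph adj ->
  (forall v, count_occ eqV s v <= K) ->
  (forall u v, adj u v = true -> count_occ eqV s u + count_occ eqV s v <= K) ->
  feasible adj s K.
Proof.
  intros (_ & _ & c & Hc) Hv Hadj.
  set (rk i v := count_occ eqV (firstn i s) v).
  (* The rank is below the load of its vertex, hence below [K], so the truncated subtraction is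
     exact. *)
  exists (fun i => match nth_error s i with
                   | Some v => if c v then rk i v else K - 1 - rk i v
                   | None => 0 end).
  split.
  - intros i j u v Hij Hi Hj Huv. rewrite Hi, Hj.
    pose proof (count_occ_firstn_total eqV s i u Hi) as Ri.
    pose proof (count_occ_firstn_total eqV s j v Hj) as Rj.
    fold (rk i u) in Ri. fold (rk j v) in Rj.
    destruct Huv as [<-|Huv].
    + pose proof (count_occ_firstn_lt eqV s i j u Hij Hi) as Hlt.
      fold (rk i u) in Hlt. fold (rk j u) in Hlt.
      specialize (Hv u). destruct (c u); lia.
    + specialize (Hc u v Huv). specialize (Hadj u v Huv).
      destruct (c u), (c v); try congruence; lia.
  - apply Nat.le_trans with (length (seq 0 K)); [|now rewrite length_seq].
    apply num_freqs_le. intros i Hi.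
    destruct (nth_error s i) as [v|] eqn:E.
    + pose proof (count_occ_firstn_total eqV s i v E) as Ri.
      fold (rk i v) in Ri. specialize (Hv v).
      apply in_seq. destruct (c v); lia.
    + apply nth_error_None in E. lia.
Qed.

(** Competitiveness speaks only of exact optima; descending from any feasible [K] reaches one. *)
Lemma feasible_opt {V : Type} (adj : V -> V -> bool) (s : list V) K :
  feasible adj s K -> exists k, is_opt adj s k /\ k <= K.
Proof.
  induction K as [K IH] using lt_wf_ind. intros HK.
  destruct (classic (exists k, k < K /\ feasible adj s k)) as [(k & Hk & Fk)|No].
  - destruct (IH k Hk Fk) as (k' & Ho & Hle). exists k'. split; [exact Ho|lia].
  - exists K. split; [split; [exact HK|]|lia].
    intros k' Hk'. apply not_lt. intros Hlt. apply No. now exists k'.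
Qed.

(** * Frequencies seen at a vertex *)

(** Collected per request, so that the length is the load for every [f]; validity then amounts to
    the absence of duplicates. *)
Definition vertex_freqs {V : Type} (eqV : forall x y : V, {x = y} + {x <> y})
  (s : list V) (f : nat -> nat) (v : V) : list nat :=
  map f (filter (fun i => match nth_error s i with
                          | Some w => if eqV w v then true else false
                          | None => false end) (seq 0 (length s))).

Lemma in_vertex_freqs {V : Type} (eqV : forall x y : V, {x = y} + {x <> y})
  s f v g :
  In g (vertex_freqs eqV s f v) <-> exists i, nth_error s i = Some v /\ f i = g.
Proof.
  unfold vertex_freqs. rewrite in_map_iff. split.
  - intros (i & <- & Hi). apply filter_In in Hi as (_ & Hi). exists i.
    destruct (nth_error s i) as [w|]; [|discriminate].
    destruct (eqV w v) as [->|]; [auto|discriminate].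
  - intros (i & Hi & <-). exists i. split; [reflexivity|].
    apply filter_In. rewrite Hi. split.
    + apply in_seq. assert (i < length s) by (apply nth_error_Some; congruence). lia.
    + destruct (eqV v v); congruence.
Qed.

Lemma length_vertex_freqs {V : Type} (eqV : forall x y : V, {x = y} + {x <> y})
  s f v : length (vertex_freqs eqV s f v) = count_occ eqV s v.
Proof.
  unfold vertex_freqs. rewrite length_map.
  induction s as [|w s IH]; [reflexivity|].
  cbn [length seq filter nth_error count_occ].
  rewrite <- seq_shift, filter_map_swap.
  destruct (eqV w v); cbn [length]; rewrite length_map, <- IH; reflexivity.
Qed.

Lemma NoDup_vertex_freqs {V : Type} (eqV : forall x y : V, {x = y} + {x <> y})
  adj s f v : valid_assign adj s f -> NoDup (vertex_freqs eqV s f v).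
Proof.
  intros Hf. unfold vertex_freqs.
  apply NoDup_map_NoDup_ForallPairs; [|apply NoDup_filter, seq_NoDup].
  intros i j Hi Hj E.
  apply filter_In in Hi as (_ & Hi). apply filter_In in Hj as (_ & Hj).
  destruct (nth_error s i) as [w|] eqn:Ei; [|discriminate].
  destruct (eqV w v) as [->|]; [|discriminate].
  destruct (nth_error s j) as [w|] eqn:Ej; [|discriminate].
  destruct (eqV w v) as [->|]; [|discriminate].
  destruct (lt_eq_lt_dec i j) as [[H| ->]|H]; [|reflexivity|]; exfalso.
  - exact (Hf i j v v H Ei Ej (or_introl eq_refl) E).
  - exact (Hf j i v v H Ej Ei (or_introl eq_refl) (eq_sym E)).
Qed.

Lemma vertex_freqs_disjoint {V : Type} (eqV : forall x y : V, {x = y} + {x <> y})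
  adj s f u v g :
  bipartite_graph adj -> valid_assign adj s f -> adj u v = true ->
  In g (vertex_freqs eqV s f u) -> In g (vertex_freqs eqV s f v) -> False.
Proof.
  intros (Hsym & Hirr & _) Hf Huv Hu Hv.
  apply in_vertex_freqs in Hu as (i & Hi & <-).
  apply in_vertex_freqs in Hv as (j & Hj & E).
  destruct (lt_eq_lt_dec i j) as [[H| ->]|H].
  - apply (Hf i j u v H Hi Hj); [now right|congruence].
  - rewrite Hi in Hj. injection Hj as ->. rewrite Hirr in Huv. discriminate.
  - apply (Hf j i v u H Hj Hi); [right; now rewrite Hsym|congruence].
Qed.

(** This is where the algorithm being online enters: one run on the full sequence obeys the
    competitive bound at every intermediate time. *)
Lemma num_freqs_prefix (A : inc_alg) (V : Type)
  (eqV : forall x y : V, {x = y} + {x <> y}) adj (s1 s2 : list V) :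
  num_freqs (alg_freq A eqV adj (s1 ++ s2)) (length s1) =
  num_freqs (alg_freq A eqV adj s1) (length s1).
Proof.
  unfold num_freqs. do 2 f_equal. apply map_ext_in. intros i Hi.
  apply in_seq in Hi. unfold alg_freq. f_equal.
  rewrite firstn_app. replace (S i - length s1) with 0 by lia.
  now rewrite firstn_O, app_nil_r.
Qed.

(** * The adversary *)

(* The vertices [S], [V], [U] of stage [k] have the indices [3k], [3k+1], [3k+2];
   [backward p q] says that [q] is adjacent to the opposite vertex of the
   earlier index [p]. *)
Definition backward (p q : nat) : bool :=
  (p <? q) && match q mod 3 with 0 => false | 1 => p + 1 <? q | _ => true end.

Definition adv_adj (u v : bool * nat) : bool :=
  xorb (fst u) (fst v) && (backward (snd u) (snd v) || backward (snd v) (snd u)).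

Definition adv_eq_dec (x y : bool * nat) : {x = y} + {x <> y}.
Proof. decide equality; [apply Nat.eq_dec | apply bool_dec]. Defined.

(** The even factor keeps the optimum [3u/2] integral in stage 0 too; [n] is a free scale that later
    beats the additive constant. *)
Definition load (n t : nat) : nat := 2 ^ (t / 3) * (2 * n).

Fixpoint requests (n T : nat) : list (bool * nat) :=
  match T with
  | 0 => []
  | S t => requests n t ++
           (repeat (true, t) (load n t) ++ repeat (false, t) (load n t))
  end.

Lemma adv_bipartite : bipartite_graph adv_adj.
Proof.
  unfold adv_adj. split; [|split].
  - intros u v. now rewrite xorb_comm, orb_comm.
  - intros v. now rewrite xorb_nilpotent.
  - exists fst. intros u v H E. rewrite E, xorb_nilpotent in H. discriminate.
Qed.

Lemma count_requests n T b t :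
  count_occ adv_eq_dec (requests n T) (b, t) = if t <? T then load n t else 0.
Proof.
  induction T as [|T IH]; [reflexivity|].
  simpl requests. rewrite !count_occ_app, IH.
  destruct (Nat.eq_dec t T) as [->|Ht].
  - replace (T <? T) with false by (symmetry; apply Nat.ltb_ge; lia).
    replace (T <? S T) with true by (symmetry; apply Nat.ltb_lt; lia).
    destruct b.
    + rewrite count_occ_repeat_eq by reflexivity.
      rewrite count_occ_repeat_neq by congruence. lia.
    + rewrite count_occ_repeat_neq by congruence.
      rewrite count_occ_repeat_eq by reflexivity. lia.
  - rewrite !count_occ_repeat_neq by congruence.
    destruct (Nat.ltb_spec t T), (Nat.ltb_spec t (S T)); lia.
Qed.

Lemma requests_split n T M : T <= M ->
  exists s2, requests n M = requests n T ++ s2 /\ forall v, In v s2 -> T <= snd v.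
Proof.
  induction 1 as [|M H (s2 & E & IH)].
  - exists []. rewrite app_nil_r. split; [reflexivity|simpl; tauto].
  - eexists. simpl. rewrite E, <- app_assoc. split; [reflexivity|].
    intros v. rewrite !in_app_iff.
    intros [Hv|[Hv|Hv]]; [auto| |]; apply repeat_spec in Hv; subst; simpl; lia.
Qed.

Lemma nth_requests_early n T M i v : T <= M ->
  nth_error (requests n M) i = Some v -> snd v < T -> i < length (requests n T).
Proof.
  intros HT Hi Hv. destruct (requests_split n T M HT) as (s2 & E & H2).
  apply not_le. intros Hle. rewrite E, nth_error_app2 in Hi by exact Hle.
  apply nth_error_In in Hi. specialize (H2 v Hi). lia.
Qed.

Lemma load_mono n p q : p <= q -> load n p <= load n q.
Proof.
  intros H. apply Nat.mul_le_mono_r, Nat.pow_le_mono_r; [lia|].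
  apply Nat.Div0.div_le_mono. exact H.
Qed.

Lemma stage_index k j : j < 3 -> (3 * k + j) / 3 = k /\ (3 * k + j) mod 3 = j.
Proof.
  intros Hj. pose proof (Nat.div_mod_eq (3 * k + j) 3).
  pose proof (Nat.mod_upper_bound (3 * k + j) 3). lia.
Qed.

Lemma load_stage n k j : j < 3 -> load n (3 * k + j) = 2 ^ k * (2 * n).
Proof. intros Hj. unfold load. now destruct (stage_index k j Hj) as [-> _]. Qed.

Lemma requests_feasible n T K :
  (forall t, t < T -> load n t <= K) ->
  (forall p q, q < T -> backward p q = true -> load n p + load n q <= K) ->
  feasible adv_adj (requests n T) K.
Proof.
  intros H1 H2. apply (bipartite_feasible adv_eq_dec); [apply adv_bipartite| |].
  - intros [b t]. rewrite count_requests. destruct (Nat.ltb_spec t T); auto; lia.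
  - intros [a p] [b q] H. rewrite !count_requests.
    unfold adv_adj in H. simpl in H. apply andb_prop in H as (_ & H).
    apply orb_prop in H.
    destruct (Nat.ltb_spec p T) as [Hp|Hp], (Nat.ltb_spec q T) as [Hq|Hq].
    + destruct H as [H|H]; [now apply H2|].
      rewrite Nat.add_comm. now apply H2.
    + rewrite Nat.add_0_r. auto.
    + simpl. auto.
    + lia.
Qed.

(** For [q = 3k+1], [p + 1 < q] excludes the [S] of the same stage, so [p] lies in an earlier stage,
    whose unit is at most half. *)
Lemma backward_load n p q : backward p q = true ->
  (q mod 3 = 1 /\ 2 * load n p <= load n q) \/ (q mod 3 = 2 /\ load n p <= load n q).
Proof.
  unfold backward. intros H. apply andb_prop in H as (Hpq & H).
  apply Nat.ltb_lt in Hpq.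
  pose proof (Nat.mod_upper_bound q 3 ltac:(lia)) as Hm.
  pose proof (Nat.div_mod_eq q 3) as Hd.
  destruct (q mod 3) as [|[|[|j]]]; [discriminate| | |lia].
  - left. split; [reflexivity|]. apply Nat.ltb_lt in H.
    apply Nat.le_trans with (2 * load n (3 * (q / 3 - 1) + 2)).
    + apply Nat.mul_le_mono_l, load_mono. lia.
    + rewrite load_stage by lia. unfold load.
      replace (q / 3) with (S (q / 3 - 1)) at 2 by lia.
      rewrite Nat.pow_succ_r'. lia.
  - right. split; [reflexivity|]. apply load_mono. lia.
Qed.

(** The newest [S] has no edge yet, and every other edge joins two loads of at most [u/2]. *)
Lemma optimum_S n k : feasible adv_adj (requests n (3 * k + 1)) (2 ^ k * (2 * n)).
Proof.
  rewrite <- (load_stage n k 0) by lia. apply requests_feasible.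
  - intros t Ht. apply load_mono. lia.
  - intros p q Hq Hb. destruct k as [|k].
    + exfalso. assert (q = 0) as -> by lia.
      unfold backward in Hb. simpl in Hb. discriminate.
    + assert (Hne : q <> 3 * S k + 0).
      { intros ->. destruct (stage_index (S k) 0 ltac:(lia)) as [_ E].
        (* Only the residue of the index matters here; the scale [1] is arbitrary. *)
        destruct (backward_load 1 p _ Hb) as [(? & _)|(? & _)]; lia. }
      rewrite load_stage by lia.
      assert (load n q <= load n (3 * k + 2)) as Hl by (apply load_mono; lia).
      rewrite load_stage in Hl by lia. rewrite Nat.pow_succ_r'.
      destruct (backward_load n p q Hb) as [(_ & H)|(_ & H)]; lia.
Qed.

(** An edge back from a [V] costs at most [u + u/2]; an edge back from a [U] belongs to an earlier
    stage and costs at most [u]. *)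
Lemma optimum_V n k : feasible adv_adj (requests n (3 * k + 2)) (3 * (2 ^ k * n)).
Proof.
  pose proof (load_stage n k 1 ltac:(lia)) as L1.
  apply requests_feasible.
  - intros t Ht. pose proof (load_mono n t (3 * k + 1) ltac:(lia)). lia.
  - intros p q Hq Hb.
    pose proof (load_mono n q (3 * k + 1) ltac:(lia)) as Hl.
    destruct (backward_load n p q Hb) as [(_ & H)|(E & H)]; [lia|].
    pose proof (Nat.div_mod_eq q 3).
    destruct k as [|k]; [exfalso; lia|].
    pose proof (load_mono n q (3 * k + 2) ltac:(lia)) as Hl'.
    rewrite load_stage in Hl' by lia. rewrite Nat.pow_succ_r'. lia.
Qed.

(** Read at the start of stage [k]: twice the unit of the preceding stage is the unit of stage
    [k]. *)
Lemma optimum_U n k : feasible adv_adj (requests n (3 * k)) (2 ^ k * (2 * n)).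
Proof.
  apply requests_feasible.
  - intros t Ht. rewrite <- (load_stage n k 0) by lia. apply load_mono. lia.
  - intros p q Hq Hb. destruct k as [|k]; [lia|].
    pose proof (load_mono n q (3 * k + 2) ltac:(lia)) as Hl.
    rewrite load_stage in Hl by lia. rewrite Nat.pow_succ_r'.
    destruct (backward_load n p q Hb) as [(_ & H)|(_ & H)]; lia.
Qed.

(** * Counting frequencies in one stage *)

Definition used (s : list (bool * nat)) (f : nat -> nat) (v : bool * nat)
  (g : nat) : bool :=
  if in_dec Nat.eq_dec g (vertex_freqs adv_eq_dec s f v) then true else false.

(** Time is encoded by vertex index: [s] stays the whole run, and [T] cuts off the later vertices.
    All counts thus range over one fixed list of frequencies and can be summed pointwise. *)
Definition seen (s : list (bool * nat)) (f : nat -> nat) (b : bool) (T g : nat) :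
  bool := existsb (fun t => used s f (b, t) g) (seq 0 T).

Definition num_seen (s : list (bool * nat)) (f : nat -> nat) (P : nat -> bool) :
  nat := length (filter P (nodup Nat.eq_dec (map f (seq 0 (length s))))).

Lemma used_in s f v g :
  used s f v g = true <-> In g (vertex_freqs adv_eq_dec s f v).
Proof. unfold used. destruct in_dec; split; congruence || tauto. Qed.

Lemma seen_in s f b T g : seen s f b T g = true <->
  exists t, t < T /\ In g (vertex_freqs adv_eq_dec s f (b, t)).
Proof.
  unfold seen. rewrite existsb_exists. split; intros (t & H1 & H2); exists t.
  - apply in_seq in H1. split; [lia|]. now apply used_in.
  - split; [apply in_seq; lia|]. now apply used_in.
Qed.

Lemma seen_S s f b T g : seen s f b (S T) g = seen s f b T g || used s f (b, T) g.
Proof. unfold seen. rewrite seq_S, existsb_app. simpl. now rewrite orb_false_r. Qed.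

Lemma num_seen_used s f v : valid_assign adv_adj s f ->
  count_occ adv_eq_dec s v <= num_seen s f (used s f v).
Proof.
  intros Hf. rewrite <- (length_vertex_freqs adv_eq_dec s f v).
  apply NoDup_incl_length; [now apply (NoDup_vertex_freqs adv_eq_dec adv_adj)|].
  intros g Hg. apply filter_In. split; [|now apply used_in].
  apply nodup_In. apply in_vertex_freqs in Hg as (i & Hi & <-).
  apply in_map, in_seq.
  assert (i < length s) by (apply nth_error_Some; congruence). lia.
Qed.

Lemma num_seen_both n f T M : T <= M ->
  num_seen (requests n M) f
    (fun g => seen (requests n M) f true T g || seen (requests n M) f false T g)
  <= num_freqs f (length (requests n T)).
Proof.
  intros HT. apply NoDup_incl_length; [apply NoDup_filter, NoDup_nodup|].
  intros g Hg. apply filter_In in Hg as (_ & Hg). apply nodup_In.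
  assert (exists b, seen (requests n M) f b T g = true) as (b & Hb)
    by (apply orb_prop in Hg as [Hg|Hg]; eauto).
  apply seen_in in Hb as (t & Ht & Hg').
  apply in_vertex_freqs in Hg' as (i & Hi & <-).
  apply in_map, in_seq.
  pose proof (nth_requests_early n T M i (b, t) HT Hi Ht). lia.
Qed.

Lemma used_disjoint s f b p q g : valid_assign adv_adj s f ->
  backward p q = true -> used s f (b, p) g = true ->
  used s f (negb b, q) g = true -> False.
Proof.
  intros Hf Hb H1 H2. apply used_in in H1. apply used_in in H2.
  revert H1 H2. apply (vertex_freqs_disjoint adv_eq_dec adv_adj); trivial.
  - apply adv_bipartite.
  - unfold adv_adj. simpl. rewrite Hb. now destruct b.
Qed.

Lemma seen_used_disjoint s f b T q g : valid_assign adv_adj s f ->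
  (forall p, p < T -> backward p q = true) -> seen s f b T g = true ->
  used s f (negb b, q) g = true -> False.
Proof.
  intros Hf Hb H1 H2. apply seen_in in H1 as (t & Ht & H1).
  apply used_in in H1. now apply (used_disjoint s f b t q g Hf (Hb t Ht)).
Qed.

Lemma backward_V k p : p < 3 * k -> backward p (3 * k + 1) = true.
Proof.
  intros H. unfold backward. destruct (stage_index k 1 ltac:(lia)) as [_ ->].
  apply andb_true_intro. split; apply Nat.ltb_lt; lia.
Qed.

Lemma backward_U k p : p < 3 * k + 2 -> backward p (3 * k + 2) = true.
Proof.
  intros H. unfold backward. destruct (stage_index k 2 ltac:(lia)) as [_ ->].
  apply andb_true_intro. split; [apply Nat.ltb_lt; lia|reflexivity].
Qed.

(** If [g] is on both sides after [S], it is at no [U], and being at a [V] excludes the opposite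
    side before the stage: at most 8 on the left, 8 on the right. If it is on one side only, at most
    7 faces at least 7. If it is absent then, two, one or no [V] give 4 against 4, at most 3 against
    at least 3, or the [U] terms against [x'A+x'B]. *)
Lemma stage_pointwise s f k g : valid_assign adv_adj s f ->
  let S b := Nat.b2n (used s f (b, 3 * k) g) in
  let V b := Nat.b2n (used s f (b, 3 * k + 1) g) in
  let U b := Nat.b2n (used s f (b, 3 * k + 2) g) in
  let X b T := seen s f b T g in
  2 * (S true + S false + V true + V false) + U true + U false
    + 2 * (Nat.b2n (X true (3 * k)) + Nat.b2n (X false (3 * k)))
  <= Nat.b2n (X true (3 * k + 3)) + Nat.b2n (X false (3 * k + 3))
     + 4 * Nat.b2n (X true (3 * k + 1) || X false (3 * k + 1))
     + 2 * Nat.b2n (X true (3 * k + 2) || X false (3 * k + 2)).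
Proof.
  intros Hf S V U X. unfold S, V, U, X. clear S V U X.
  pose proof (fun b => seen_used_disjoint s f b (3 * k) (3 * k + 1) g Hf
    (backward_V k)) as HV.
  pose proof (fun b => seen_used_disjoint s f b (3 * k + 2) (3 * k + 2) g Hf
    (backward_U k)) as HU.
  pose proof (HV true) as VT. pose proof (HV false) as VF.
  pose proof (HU true) as UT. pose proof (HU false) as UF.
  clear HV HU. cbn [negb] in *.
  replace (3 * k + 3) with (Datatypes.S (Datatypes.S (Datatypes.S (3 * k)))) by lia.
  replace (3 * k + 2) with (Datatypes.S (Datatypes.S (3 * k))) in * by lia.
  replace (3 * k + 1) with (Datatypes.S (3 * k)) in * by lia.
  rewrite !seen_S in *.
  (* Every later indicator is a disjunction of these eight. *)
  destruct (seen s f true (3 * k) g), (seen s f false (3 * k) g),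
    (used s f (true, 3 * k) g), (used s f (false, 3 * k) g),
    (used s f (true, Datatypes.S (3 * k)) g),
    (used s f (false, Datatypes.S (3 * k)) g),
    (used s f (true, Datatypes.S (Datatypes.S (3 * k))) g),
    (used s f (false, Datatypes.S (Datatypes.S (3 * k))) g);
    simpl in *; try lia; exfalso; auto.
Qed.

Lemma num_seen_sum s f P :
  num_seen s f P =
  list_sum (map (fun g => Nat.b2n (P g))
              (nodup Nat.eq_dec (map f (seq 0 (length s))))).
Proof.
  unfold num_seen. induction nodup as [|g l IH]; [reflexivity|].
  simpl. destruct (P g); simpl; now rewrite <- IH.
Qed.

Lemma stage_count s f k : valid_assign adv_adj s f ->
  let N b t := num_seen s f (used s f (b, t)) in
  let X b T := num_seen s f (seen s f b T) in
  let Y T := num_seen s f (fun g => seen s f true T g || seen s f false T g) in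
  2 * (N true (3 * k) + N false (3 * k) + N true (3 * k + 1) + N false (3 * k + 1))
    + N true (3 * k + 2) + N false (3 * k + 2)
    + 2 * (X true (3 * k) + X false (3 * k))
  <= X true (3 * k + 3) + X false (3 * k + 3)
     + 4 * Y (3 * k + 1) + 2 * Y (3 * k + 2).
Proof.
  intros Hf N X Y. unfold N, X, Y. clear N X Y. rewrite !num_seen_sum.
  induction nodup as [|g l IH]; [simpl; lia|].
  pose proof (stage_pointwise s f k g Hf) as H.
  unfold list_sum in *. cbn [map fold_right] in *. cbv zeta in H. lia.
Qed.

(** * The lower bound *)

(** As [r] is nonnegative, the bound is monotone in the optimum, so upper bounds on the optimum
    suffice. *)
Lemma competitive_feasible A r V eqV adj (lambda : R) (s : list V) K :
  (0 <= r)%R ->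
  (forall k, is_opt adj s k ->
    (INR (num_freqs (alg_freq A eqV adj s) (length s)) <= r * INR k + lambda)%R) ->
  feasible adj s K ->
  (INR (num_freqs (alg_freq A eqV adj s) (length s)) <= r * INR K + lambda)%R.
Proof.
  intros Hr H HK. destruct (feasible_opt adj s K HK) as (k & Ho & Hle).
  specialize (H k Ho). apply le_INR in Hle. nra.
Qed.

Lemma adversary_bound A r lambda : (0 <= r)%R -> (0 <= lambda)%R ->
  (forall s, valid_assign adv_adj s (alg_freq A adv_eq_dec adv_adj s) /\
     forall k, is_opt adv_adj s k ->
       (INR (num_freqs (alg_freq A adv_eq_dec adv_adj s) (length s))
        <= r * INR k + lambda)%R) ->
  forall m n : nat,
  (INR (2 * n) * (INR m * (10 - 7 * r) / 2 - 2 * r) <= 8 * lambda)%R.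
Proof.
  intros Hr Hl HA m n.
  set (s := requests n (3 * m)). set (f := alg_freq A adv_eq_dec adv_adj s).
  destruct (HA s) as [Hf _]. fold f in Hf.
  set (Y T := num_seen s f (fun g => seen s f true T g || seen s f false T g)).
  set (c k := num_seen s f (seen s f true (3 * k))
              + num_seen s f (seen s f false (3 * k))).
  assert (HY : forall T K, T <= 3 * m -> feasible adv_adj (requests n T) K ->
                 (INR (Y T) <= r * INR K + lambda)%R).
  { intros T K HT HK. eapply Rle_trans.
    - apply le_INR, (num_seen_both n f T (3 * m) HT).
    - unfold f, s. destruct (requests_split n T (3 * m) HT) as (s2 & -> & _).
      rewrite num_freqs_prefix.
      apply competitive_feasible; [exact Hr|apply HA|exact HK]. }
  assert (Hstep : forall k, k < m ->
    (INR (c (S k)) >= 2 * INR (c k)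
       + 2 ^ k * INR (2 * n) * (10 - 7 * r) - 6 * lambda)%R).
  { intros k Hk. pose proof (stage_count s f k Hf) as H. cbv zeta in H.
    replace (3 * k + 3) with (3 * S k) in H by lia.
    assert (L : forall b j, j < 3 ->
              2 ^ k * (2 * n) <= num_seen s f (used s f (b, 3 * k + j))).
    { intros b j Hj. eapply Nat.le_trans; [|now apply num_seen_used].
      unfold s. rewrite count_requests.
      destruct (Nat.ltb_spec (3 * k + j) (3 * m)); [|lia].
      now rewrite load_stage. }
    pose proof (L true 0 ltac:(lia)) as L1. pose proof (L false 0 ltac:(lia)) as L2.
    pose proof (L true 1 ltac:(lia)) as L3. pose proof (L false 1 ltac:(lia)) as L4.
    pose proof (L true 2 ltac:(lia)) as L5. pose proof (L false 2 ltac:(lia)) as L6.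
    rewrite Nat.add_0_r in L1, L2.
    assert (N : 10 * (2 ^ k * (2 * n)) + 2 * c k
                <= c (S k) + 4 * Y (3 * k + 1) + 2 * Y (3 * k + 2)).
    { unfold c, Y. lia. }
    pose proof (HY (3 * k + 1) _ ltac:(lia) (optimum_S n k)) as H1.
    pose proof (HY (3 * k + 2) _ ltac:(lia) (optimum_V n k)) as H2.
    apply le_INR in N. rewrite !plus_INR, !mult_INR, !pow_INR in *.
    simpl INR in *. replace (1 + 1)%R with 2%R in * by lra. lra. }
  (* [6 * lambda] is the fixed point of [x => 2 * x - 6 * lambda]; after subtracting it and dividing
     by [2 ^ k], each stage adds [INR (2 * n) * (10 - 7 * r) / 2]. *)
  assert (Hgrow : forall k, k <= m ->
    (INR (c k) >= 2 ^ k * (INR (2 * n) * (INR k * (10 - 7 * r) / 2) - 6 * lambda)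
       + 6 * lambda)%R).
  { induction k as [|k IH]; intros Hk.
    - pose proof (pos_INR (c 0)). simpl (2 ^ 0)%R. simpl (INR 0). lra.
    - specialize (IH ltac:(lia)). specialize (Hstep k ltac:(lia)).
      rewrite S_INR. simpl (2 ^ S k)%R. nra. }
  specialize (Hgrow m (le_n m)).
  pose proof (HY (3 * m) _ (le_n _) (optimum_U n m)) as Hend.
  (* A frequency counts at most twice in [c m], once per side. *)
  assert (Hc : c m <= 2 * Y (3 * m)).
  { unfold c, Y. rewrite !num_seen_sum.
    induction nodup as [|g l IH]; [simpl; lia|].
    unfold list_sum in *. cbn [map fold_right] in *.
    destruct (seen s f true (3 * m) g), (seen s f false (3 * m) g);
      cbn [Nat.b2n orb]; lia. }
  apply le_INR in Hc. rewrite mult_INR in Hc. change (INR 2) with 2%R in Hc.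
  rewrite (mult_INR (2 ^ m)), pow_INR in Hend. change (INR 2) with 2%R in Hend.
  assert (Hp : (1 <= 2 ^ m)%R) by (apply pow_R1_Rle; lra).
  set (N := INR (2 * n)) in *.
  apply Rmult_le_reg_l with (2 ^ m)%R; [lra|].
  assert (lambda <= 2 ^ m * lambda)%R by nra. lra.
Qed.

Theorem theorem2 (A : inc_alg) (r : R) :
  competitive_bip A r -> (10 / 7 <= r)%R.
Proof.
  intros [lambda H]. apply Rnot_lt_le. intros Hr.
  (* Both constants may be negative; their positive parts only weaken the competitive bound. *)
  set (r' := Rmax r 0). set (l' := Rmax lambda 0).
  assert (Hr' : (0 <= r' < 10 / 7)%R).
  { split; [apply Rmax_r|]. apply Rmax_lub_lt; lra. }
  assert (Hl' : (0 <= l')%R) by apply Rmax_r.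
  assert (B : forall m n : nat,
    (INR (2 * n) * (INR m * (10 - 7 * r') / 2 - 2 * r') <= 8 * l')%R).
  { apply (adversary_bound A); [lra|exact Hl'|]. intros s.
    destruct (H _ adv_eq_dec adv_adj adv_bipartite s) as [Hv Ho].
    split; [exact Hv|]. intros k Hk. specialize (Ho k Hk).
    pose proof (Rmax_l r 0 : r <= r')%R. pose proof (Rmax_l lambda 0 : lambda <= l')%R.
    pose proof (pos_INR k). nra. }
  (* Enough stages [m] raise the bracket in [B] to at least 1; then the scale [n] alone exceeds
     [8 * l']. *)
  destruct (INR_unbounded ((2 * r' + 1) * 2 / (10 - 7 * r'))) as [m Hm].
  destruct (INR_unbounded (8 * l')) as [n Hn].
  specialize (B m n).
  assert (Hd : (0 < 10 - 7 * r')%R) by lra.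
  assert (Hm' : (1 <= INR m * (10 - 7 * r') / 2 - 2 * r')%R).
  { apply Rmult_gt_compat_r with (r := (10 - 7 * r')%R) in Hm; [|exact Hd].
    unfold Rdiv in Hm. rewrite Rmult_assoc, Rinv_l in Hm by lra. lra. }
  rewrite mult_INR in B. simpl (INR 2) in B. pose proof (pos_INR n). nra.
Qed.
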